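(* Let $R$ be a commutative Noetherian ring, let $\mathcal{F}=\{I_i\}_{i\in\mathbb{N}}$ be a filtration of $R$, and let $\mathcal{F}_{\mathrm{sym}}=\{I_{(i)}\}_{i\in\mathbb{N}}$ be the symbolic filtration associated with $\mathcal{F}$. If $\mathcal{F}$ is strongly persistent, then $\mathcal{F}_{\mathrm{sym}}$ is strongly persistent.
   Context: $\mathbb{N}$ denotes the nonnegative integers. A filtration of a ring $R$ is a family of ideals $\{I_n\}_{n\in\mathbb{N}}$ of $R$ such that (i) $I_0=R$; (ii) $I_{n+1}\subseteq I_n$ for all $n\in\mathbb{N}$; (iii) $I_nI_m\subseteq I_{n+m}$ for all $n,m\in\mathbb{N}$. For an ideal $I$ of $R$, $\mathrm{Min}(I)$ is the set of minimal primes of $I$. If $I=\bigcap_{j=1}^r Q_j$ is a minimal primary decomposition, the first symbolic power of $I$ is $I^{(1)}:=\bigcap_{\sqrt{Q_j}\in\mathrm{Min}(I)}Q_j$; equivalently, $I^{(1)}=\bigcap_{\mathfrak p\in\mathrm{Min}(I)}(IR_{\mathfrak p}\cap R)$, where $IR_{\mathfrak p}\cap R$ is the preimage of $IR_{\mathfrak p}$ under $R\to R_{\mathfrak p}$ (an empty intersection being $R$). The symbolic filtration associated with a filtration $\mathcal{F}=\{I_i\}_{i\in\mathbb{N}}$ is $\mathcal{F}_{\mathrm{sym}}:=\{I_{(i)}\}_{i\in\mathbb{N}}$, where $I_{(0)}:=R$ and $I_{(i)}:=I_i^{(1)}$ (the first symbolic power of the ideal $I_i$); it is again a filtration of $R$.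 For ideals $A,B$ of $R$, $(A:B)=\{x\in R: xB\subseteq A\}$. A filtration $\{I_i\}_{i\in\mathbb{N}}$ is strongly persistent if $(I_{i+1}:I_1)=I_i$ for all $i\in\mathbb{N}$. *)

(* Defs.v *)
From HB Require Import structures.
From mathcomp Require Import all_boot all_order all_algebra.
From mathcomp Require Import boolp classical_sets.
From mathcomp Require Import ring.
Set Implicit Arguments.
Unset Strict Implicit.
Unset Printing Implicit Defensive.
Import GRing.Theory.
Local Open Scope ring_scope.
Local Open Scope classical_set_scope.
Local Open Scope quotient_scope.

(* The ideals of ring_quotient.v are proper and decidable; here an ideal is
   a Prop-valued set, possibly the whole ring. *)
Section Ideals.
Variable R : comPzRingType.
Implicit Types I J P Q : set R.

Definition ideal I :=
  [/\ I 0, forall x y, I x -> I y -> I (x + y) & forall a x, I x -> I (a * x)].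

Definition ideal_gen (A : set R) : set R := smallest ideal A.

Definition noetherian :=
  forall I, ideal I -> exists s : seq R, I = ideal_gen [set` s].

Definition ideal_mul I J : set R := ideal_gen [set x * y | x in I & y in J].

Definition colon I J : set R := [set x | forall y, J y -> I (x * y)].

Definition prime_ideal P :=
  [/\ ideal P, ~ P 1 & forall x y, P (x * y) -> P x \/ P y].

Definition Min I : set (set R) :=
  [set P | [/\ prime_ideal P, I `<=` P &
     forall P', prime_ideal P' -> I `<=` P' -> P' `<=` P -> P' = P]].

Definition radical I : set R := [set x | exists n, I (x ^+ n)].

Definition primary Q :=
  [/\ ideal Q, ~ Q 1 & forall x y, Q (x * y) -> Q x \/ radical Q y].

Definition minimal_primary_decomposition I (r : nat) (Q : 'I_r -> set R) :=
  [/\ forall j, primary (Q j),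
      I = \bigcap_j Q j,
      injective (fun j => radical (Q j)) &
      forall j, ~ (\bigcap_(k in [set k | k != j]) Q k `<=` Q j)].

End Ideals.

Structure filtration (R : comPzRingType) := Filtration {
  filtration_fun :> nat -> set R;
  filtration_ideal : forall n, ideal (filtration_fun n);
  filtration0 : filtration_fun 0%N = setT;
  filtrationS : forall n, filtration_fun n.+1 `<=` filtration_fun n;
  filtrationM : forall n m, ideal_mul (filtration_fun n) (filtration_fun m)
                            `<=` filtration_fun (n + m)%N
}.

Definition strongly_persistent (R : comPzRingType) (F : filtration R) :=
  forall i, colon (F i.+1) (F 1%N) = F i.

Structure primeIdeal (R : comPzRingType) :=
  PrimeIdeal { prime_set :> set R; prime_setP : prime_ideal prime_set }.

Module Localization.
Section Localization.
Variables (R : comPzRingType) (p : primeIdeal R).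

Lemma den1 : 1 \in ~` (p : set R).
Proof. by apply/mem_set; have [] := prime_setP p. Qed.

Lemma denM (s t : ~` (p : set R)) : sval s * sval t \in ~` (p : set R).
Proof.
have [_ _ pM] := prime_setP p.
apply/mem_set => /pM; have /set_mem := valP s; have /set_mem := valP t.
by move=> nt ns [].
Qed.

Definition one_den : ~` (p : set R) := exist (fun s => s \in ~` (p : set R)) 1 den1.
Definition mul_den (s t : ~` (p : set R)) : ~` (p : set R) :=
  exist (fun u => u \in ~` (p : set R)) _ (denM s t).

Definition dom : Type := (R * set_type (~` (p : set R)))%type.
HB.instance Definition _ := Choice.on dom.
Implicit Types x y z : dom.
Local Notation "\n x" := (x.1 : R) (at level 8, x at level 2).
Local Notation "\d x" := (sval x.2 : R) (at level 8, x at level 2).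

(* The factor u is needed because R may have zero divisors. *)
Definition equivl x y : bool :=
  `[< exists u : ~` (p : set R), sval u * (\n x * \d y) = sval u * (\n y * \d x) >].

Lemma equivl_refl : reflexive equivl.
Proof. by move=> x; apply/asboolP; exists x.2. Qed.

Lemma equivl_sym : symmetric equivl.
Proof. by move=> x y; apply/asboolP/asboolP => -[u e]; exists u. Qed.

Lemma equivl_trans : transitive equivl.
Proof.
move=> y x z /asboolP[u xy] /asboolP[v yz]; apply/asboolP.
exists (mul_den (mul_den u v) y.2) => /=.
transitivity (sval v * \d z * (sval u * (\n x * \d y))); first by ring.
rewrite xy.
transitivity (sval u * \d x * (sval v * (\n y * \d z))); first by ring.
by rewrite yz; ring.
Qed.

Canonical equivl_equiv := EquivRel equivl equivl_refl equivl_sym equivl_trans.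

Definition type := {eq_quot equivl}.
HB.instance Definition _ : EqQuotient _ equivl type := EqQuotient.on type.
HB.instance Definition _ := Choice.on type.

Lemma equivl_repr x : exists u : ~` (p : set R),
  sval u * (\n x * \d (repr (\pi_type x))) = sval u * (\n (repr (\pi_type x)) * \d x).
Proof.
have /eqmodP/asboolP[u e] : x = repr (\pi_type x) %[mod type] by rewrite reprK.
by exists u.
Qed.

Definition frac (a : R) : type := \pi_type (a, one_den).

Definition addl x y : dom := (\n x * \d y + \n y * \d x, mul_den x.2 y.2).
Definition add := lift_op2 type addl.

Lemma pi_add : {morph \pi : x y / addl x y >-> add x y}.
Proof.
move=> x y; unlock add; apply/eqmodP/asboolP => /=.
have [u ex] := equivl_repr x; have [v ey] := equivl_repr y.
exists (mul_den u v) => /=.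
set x' := repr (\pi_type x) in ex *; set y' := repr (\pi_type y) in ey *.
transitivity (sval u * (\n x * \d x') * (sval v * \d y * \d y')
  + sval v * (\n y * \d y') * (sval u * \d x * \d x')); first by ring.
by rewrite ex ey; ring.
Qed.
Canonical pi_add_morph := PiMorph2 pi_add.

Definition oppl x : dom := (- \n x, x.2).
Definition opp := lift_op1 type oppl.

Lemma pi_opp : {morph \pi : x / oppl x >-> opp x}.
Proof.
move=> x; unlock opp; apply/eqmodP/asboolP => /=.
by have [u ex] := equivl_repr x; exists u; rewrite /= !mulNr !mulrN ex.
Qed.
Canonical pi_opp_morph := PiMorph1 pi_opp.

Definition mull x y : dom := (\n x * \n y, mul_den x.2 y.2).
Definition mul := lift_op2 type mull.

Lemma pi_mul : {morph \pi : x y / mull x y >-> mul x y}.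
Proof.
move=> x y; unlock mul; apply/eqmodP/asboolP => /=.
have [u ex] := equivl_repr x; have [v ey] := equivl_repr y.
exists (mul_den u v) => /=.
set x' := repr (\pi_type x) in ex *; set y' := repr (\pi_type y) in ey *.
transitivity (sval u * (\n x * \d x') * (sval v * (\n y * \d y'))); first by ring.
by rewrite ex ey; ring.
Qed.
Canonical pi_mul_morph := PiMorph2 pi_mul.

Lemma equivlW x y : \n x * \d y = \n y * \d x -> \pi_type x = \pi_type y.
Proof. by move=> e; apply/eqmodP/asboolP; exists one_den; rewrite e. Qed.

Lemma addA : associative add.
Proof.
elim/quotW=> x; elim/quotW=> y; elim/quotW=> z.
by rewrite !piE; apply: equivlW => /=; ring.
Qed.

Lemma addC : commutative add.
Proof.
by elim/quotW=> x; elim/quotW=> y; rewrite !piE; apply: equivlW => /=; ring.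
Qed.

Lemma add0 : left_id (frac 0) add.
Proof.
by elim/quotW=> x; rewrite /frac !piE; apply: equivlW => /=; ring.
Qed.

Lemma addN : left_inverse (frac 0) opp add.
Proof.
by elim/quotW=> x; rewrite /frac !piE; apply: equivlW => /=; ring.
Qed.

HB.instance Definition _ := GRing.isZmodule.Build type addA addC add0 addN.

Lemma mulA : associative mul.
Proof.
elim/quotW=> x; elim/quotW=> y; elim/quotW=> z.
by rewrite !piE; apply: equivlW => /=; ring.
Qed.

Lemma mulC : commutative mul.
Proof.
by elim/quotW=> x; elim/quotW=> y; rewrite !piE; apply: equivlW => /=; ring.
Qed.

Lemma mul1 : left_id (frac 1) mul.
Proof.
by elim/quotW=> x; rewrite /frac !piE; apply: equivlW => /=; ring.
Qed.

Lemma mulDl : left_distributive mul add.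
Proof.
elim/quotW=> x; elim/quotW=> y; elim/quotW=> z.
by rewrite !piE; apply: equivlW => /=; ring.
Qed.

HB.instance Definition _ :=
  GRing.Zmodule_isComPzRing.Build type mulA mulC mul1 mulDl.

End Localization.
End Localization.

HB.export Localization.

Notation localization := Localization.type.

Section LocalizationMap.
Variables (R : comPzRingType) (p : primeIdeal R).

Definition to_localization : R -> localization p := @Localization.frac R p.

Lemma to_localization_is_zmod_morphism : zmod_morphism to_localization.
Proof.
move=> a b; rewrite /to_localization /Localization.frac.
rewrite -[X in _ = _ + X]Localization.pi_opp -[RHS]Localization.pi_add.
by apply: Localization.equivlW => /=; ring.
Qed.

Lemma to_localization_is_monoid_morphism : monoid_morphism to_localization.
Proof.
split=> // a b; rewrite /to_localization /Localization.frac.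
by rewrite -[RHS]Localization.pi_mul; apply: Localization.equivlW => /=; ring.
Qed.

HB.instance Definition _ := GRing.isZmodMorphism.Build R (localization p)
  to_localization to_localization_is_zmod_morphism.
HB.instance Definition _ := GRing.isMonoidMorphism.Build R (localization p)
  to_localization to_localization_is_monoid_morphism.

Definition extension (I : set R) : set (localization p) :=
  ideal_gen (to_localization @` I).

Definition contraction (J : set (localization p)) : set R :=
  to_localization @^-1` J.

End LocalizationMap.

Arguments to_localization {R} p x.
Arguments extension {R} p I.
Arguments contraction {R} p J.

Section SymbolicPower.
Variable R : comPzRingType.
Implicit Types (I : set R) (F : filtration R).

Definition first_symbolic_power I : set R :=
  \bigcap_(p in [set p : primeIdeal R | Min I p]) contraction p (extension p I).

Lemma contraction_extensionP (p : primeIdeal R) I x : ideal I ->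
  contraction p (extension p I) x <-> exists2 u : R, ~ prime_set p u & I (u * x).
Proof.
move=> [I0 ID IM]; have [[_ _ pM] p1 _] := prime_setP p; split.
  pose K : set (localization p) :=
    [set z | exists2 a : Localization.dom p,
       I a.1 & z = \pi_(localization p) a].
  have K_ideal : ideal K.
    split.
    - by exists (0, Localization.one_den p).
    - move=> _ _ [a aI ->] [b bI ->].
      exists (Localization.addl a b); last first.
        by rewrite -[LHS]Localization.pi_add.
      by rewrite /= ![_ * sval _]mulrC; apply: ID; exact: IM.
    - elim/quotW => a _ [b bI ->].
      exists (Localization.mull a b); last first.
        by rewrite -[LHS]Localization.pi_mul.
      exact: IM.
  have subK : to_localization p @` I `<=` K.
    by move=> _ [a aI <-]; exists (a, Localization.one_den p).
  move=> /(smallest_sub K_ideal subK) [[a s] /= aI /eqmodP/asboolP[u /= e]].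
  exists (sval u * sval s); first exact/set_mem/Localization.denM.
  by rewrite -mulrA [sval s * x]mulrC e; apply: IM; rewrite mulr1.
move=> [u /mem_set pu uxI] J [[_ _ JM] /(_ (to_localization p (u * x))) JI].
pose v : localization p :=
  \pi_(localization p) ((1, exist _ u pu) : Localization.dom p).
suff -> : to_localization p x = v * to_localization p (u * x).
  by apply: JM; apply: JI; exists (u * x).
rewrite -[RHS]Localization.pi_mul; apply: Localization.equivlW => /=.
by ring.
Qed.

Lemma ideal_sum I (T : Type) (r : seq T) (f : T -> R) : ideal I ->
  (forall t, I (f t)) -> I (\sum_(t <- r) f t).
Proof. by move=> [I0 ID _] fI; elim/big_ind: _. Qed.

Lemma prime_radical (Q : set R) : primary Q -> prime_ideal (radical Q).
Proof.
move=> [[Q0 QD QM] Q1 Qpr].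
have radM a x : radical Q x -> radical Q (a * x).
  by move=> [n xn]; exists n; rewrite exprMn; exact: QM.
split; [split => //| |].
- by exists 1%N.
- move=> x y [m xm] [n yn]; exists (m + n)%N; rewrite exprDn.
  apply: ideal_sum => // -[i /= _]; rewrite -mulr_natl; apply: (QM).
  have [ni|/ltnW ni] := leqP n i.
    by rewrite -(subnK ni) exprD mulrA; exact: QM.
  by rewrite -addnBA // exprD mulrC [x ^+ m * _]mulrC mulrA; exact: QM.
- by move=> [n]; rewrite expr1n.
- move=> x y [n]; rewrite exprMn => /Qpr[xn|[m]]; first by left; exists n.
  by rewrite -exprM => yn; right; exists (n * m)%N.
Qed.

Lemma prime_avoid_prod (p : primeIdeal R) (r : nat) (A : set 'I_r)
    (Q : 'I_r -> set R) : (forall k, ideal (Q k)) ->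
  (forall k, A k -> ~ (Q k `<=` p)) ->
  exists2 s, ~ prime_set p s & forall k, A k -> Q k s.
Proof.
move=> Qi Qp; have [_ p1 pM] := prime_setP p.
have /choice[f fP] k : exists s, ~ prime_set p s /\ (A k -> Q k s).
  have [kA|nkA] := pselect (A k); last by exists 1.
  have /existsNP[s /not_implyP[sQ ps]] := Qp _ kA.
  by exists s.
exists (\prod_k f k).
  elim/big_ind: _ => //; last by move=> k _; case: (fP k).
  by move=> x y nx ny /pM[].
move=> k kA; rewrite (bigD1 k) //= mulrC; case: (Qi k) => _ _; apply.
by case: (fP k) => _; apply.
Qed.

(* first_symbolic_power I is the intersection of the primary components of I
   belonging to minimal primes, for any minimal primary decomposition. *)
Lemma first_symbolic_power_primary I (r : nat) (Q : 'I_r -> set R) :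
  minimal_primary_decomposition I Q ->
  first_symbolic_power I = \bigcap_(j in [set j | Min I (radical (Q j))]) Q j.
Proof.
move=> [Qprim defI Qinj _].
have Qi k : ideal (Q k) by case: (Qprim k).
have Ii : ideal I.
  rewrite defI; split=> [k _|x y xI yI k _|a x xI k _]; have [Q0 QD QM] := Qi k.
  - exact: Q0.
  - by apply: QD; [exact: xI|exact: yI].
  - by apply: QM; exact: xI.
apply/seteqP; split=> x.
  move=> xI j jmin; have [_ _ Qpr] := Qprim j.
  have := xI (PrimeIdeal (prime_radical (Qprim j))) jmin.
  move=> /(contraction_extensionP _ _ Ii)[u /= nu].
  by rewrite defI mulrC => /(_ j Logic.I)/Qpr[].
move=> xQ p pmin; apply/(contraction_extensionP _ _ Ii).
have [_ Ip minp] := pmin; have [_ p1 pM] := prime_setP p.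
have radp k : Q k `<=` p -> radical (Q k) = p.
  move=> Qp; apply: minp.
  - exact: prime_radical.
  - by move=> y; rewrite defI => /(_ k Logic.I) yQ; exists 1%N.
  - move=> y [n /Qp]; elim: n => [/p1//|n IHn].
    by rewrite exprS => /pM[].
have [s ps sQ] : exists2 s, ~ prime_set p s & forall k, ~ (Q k `<=` p) -> Q k s.
  exact: (@prime_avoid_prod p r [set k | ~ (Q k `<=` p)]).
exists s => //; rewrite defI => k _; have [_ _ QM] := Qi k.
have [Qp|nQp] := pselect (Q k `<=` p); last by rewrite mulrC; exact/QM/sQ.
by apply/QM/xQ; rewrite /= radp.
Qed.

Lemma ideal_gen_ideal (A : comPzRingType) (S : set A) : ideal (ideal_gen S).
Proof.
split.
- by move=> J [[J0 _ _] _].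
- move=> x y xS yS J JS; case: (JS) => -[_ JD _] _.
  by apply: JD; [exact: xS|exact: yS].
- by move=> a x xS J JS; case: (JS) => -[_ _ JM] _; apply: JM; exact: xS.
Qed.

Lemma first_symbolic_power_ideal I : ideal (first_symbolic_power I).
Proof.
split.
- move=> p _; rewrite /contraction /preimage /= raddf0.
  by case: (ideal_gen_ideal (to_localization p @` I)).
- move=> x y xI yI p pI; rewrite /contraction /preimage /= raddfD.
  case: (ideal_gen_ideal (to_localization p @` I)) => _ + _; apply.
  + exact: xI.
  + exact: yI.
- move=> a x xI p pI; rewrite /contraction /preimage /= rmorphM.
  case: (ideal_gen_ideal (to_localization p @` I)) => _ _; apply.
  exact: xI.
Qed.

Lemma filtration_prime F (P : set R) n :
  prime_ideal P -> F n.+1 `<=` P <-> F 1%N `<=` P.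
Proof.
move=> [_ P1 PM]; split=> FP; last first.
  by elim: n => // n IHn x /filtrationS/IHn.
suff expF x k : F 1%N x -> F k.+1 (x ^+ k.+1).
  move=> x /expF-/(_ n)/FP; elim: n.+1 => [/P1//|k IHk].
  by rewrite exprS => /PM[].
move=> xF; elim: k => // k IHk; rewrite exprS; apply: (@filtrationM _ F 1%N k.+1).
by move=> J [_]; apply; exists x => //; exists (x ^+ k.+1).
Qed.

Lemma filtration_Min F n m : Min (F n.+1) = Min (F m.+1).
Proof.
suff MinE k : Min (F k.+1) = Min (F 1%N) by rewrite !MinE.
apply/seteqP; split=> P [Pp FP minP]; split=> //.
- exact: (filtration_prime _ k Pp).1 FP.
- move=> Q Qp FQ; apply: minP => //; exact: (filtration_prime _ k Qp).2 FQ.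
- exact: (filtration_prime _ k Pp).2 FP.
- move=> Q Qp FQ; apply: minP => //; exact: (filtration_prime _ k Qp).1 FQ.
Qed.

Definition symbolic_fun F (i : nat) : set R :=
  if i is 0 then setT else first_symbolic_power (F i).

Lemma symbolic_fun_ideal F i : ideal (symbolic_fun F i).
Proof. by case: i => [|i] //=; exact: first_symbolic_power_ideal. Qed.

Lemma symbolic_funS F i : symbolic_fun F i.+1 `<=` symbolic_fun F i.
Proof.
case: i => // i x xF p pmin; rewrite /= (filtration_Min _ _ i.+1) in pmin.
have Fi n := @filtration_ideal _ F n.
have [u pu uxF] := (contraction_extensionP _ _ (Fi _)).1 (xF p pmin).
by apply/(contraction_extensionP _ _ (Fi _)); exists u => //; exact: filtrationS.
Qed.

Lemma symbolic_funM F i j :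
  ideal_mul (symbolic_fun F i) (symbolic_fun F j) `<=` symbolic_fun F (i + j).
Proof.
apply: smallest_sub; first exact: symbolic_fun_ideal.
move=> _ [x xF] [y yF] <-.
case: i xF => [|i] xF.
  by case: (symbolic_fun_ideal F j) => _ _; apply.
case: j yF => [|j] yF.
  by rewrite addn0 mulrC; case: (symbolic_fun_ideal F i.+1) => _ _; apply.
move=> p pmin; have Fi n := @filtration_ideal _ F n.
have pi : Min (F i.+1) p by rewrite (filtration_Min _ _ (i + j.+1)%N).
have pj : Min (F j.+1) p by rewrite (filtration_Min _ _ (i + j.+1)%N).
have [u pu uxF] := (contraction_extensionP _ _ (Fi _)).1 (xF p pi).
have [v pv vyF] := (contraction_extensionP _ _ (Fi _)).1 (yF p pj).
apply/(contraction_extensionP _ _ (Fi _)); exists (u * v).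
  by have [_ _ pM] := prime_setP p; move=> /pM[].
rewrite mulrACA; apply: (@filtrationM _ F i.+1 j.+1).
by move=> J [_]; apply; exists (u * x) => //; exists (v * y).
Qed.

Definition symbolic_filtration F : filtration R :=
  Filtration (symbolic_fun_ideal F) erefl (symbolic_funS (F := F))
    (symbolic_funM (F := F)).

End SymbolicPower.

(* Main.v *)
(* Noetherianity makes [I_1] finitely generated, so taking colons by [I_1]
   commutes with localization: if [x I_(1)] lies in [I_(i+1)], then at each
   minimal prime [p] a single [u] outside [p] gives [u x I_1] inside [I_{i+1}],
   hence [u x] lies in [I_i] by strong persistence. All the [I_i], [i > 0], have
   the same minimal primes, so [x] lies in [I_(i)]. *)
Require Import Defs.
From mathcomp Require Import all_boot all_algebra.
From mathcomp Require Import boolp classical_sets.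

Import GRing.Theory.
Local Open Scope ring_scope.
Local Open Scope classical_set_scope.

Lemma sub_first_symbolic_power {R : comPzRingType} (I : set R) :
  ideal I -> I `<=` first_symbolic_power I.
Proof.
move=> Ii x Ix p _; apply/(contraction_extensionP _ _ Ii).
by exists 1; [case: (prime_setP p)|rewrite mul1r].
Qed.

Lemma colon_ideal {R : comPzRingType} (I J : set R) : ideal I -> ideal (colon I J).
Proof.
move=> [I0 ID IM]; split.
- by move=> y _; rewrite mul0r.
- by move=> x y xI yI z Jz; rewrite mulrDl; apply: ID; [exact: xI|exact: yI].
- by move=> a x xI z Jz; rewrite -mulrA; apply: IM; exact: xI.
Qed.

(** By commutativity, the multipliers sending [x] into [I] form the ideal [colon I [set x]], so
    testing generators suffices. *)
Lemma ideal_gen_sub_colon {R : comPzRingType} (I A : set R) (x : R) :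
  ideal I -> (forall a, A a -> I (x * a)) -> colon I (ideal_gen A) x.
Proof.
move=> Ii xA y Ay; rewrite mulrC.
have: ideal_gen A `<=` colon I [set x].
  apply: smallest_sub; first exact: colon_ideal.
  by move=> a Aa _ ->; rewrite mulrC; exact: xA.
by move=> /(_ y Ay); apply.
Qed.

(** Multiply the finitely many denominators: the product avoids [p] by primality. *)
Lemma common_denominator {R : comPzRingType} (p : primeIdeal R) (I : set R)
    (s : seq R) (x : R) : ideal I ->
  {in s, forall a, exists2 u, ~ prime_set p u & I (u * (x * a))} ->
  exists2 u, ~ prime_set p u & {in s, forall a, I (u * (x * a))}.
Proof.
move=> [I0 ID IM]; have [_ p1 pM] := prime_setP p.
elim: s => [|b s IHs] sP; first by exists 1.
have [u pu uI] := sP b (mem_head _ _).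
have [a sa|v pv vI] := IHs; first by apply: sP; rewrite inE sa orbT.
exists (u * v) => [/pM[]//|a]; rewrite inE => /orP[/eqP->|/vI va].
- by rewrite [u * v]mulrC -mulrA; exact: IM.
- by rewrite -mulrA; exact: IM.
Qed.

Theorem corollary3p6 (R : comPzRingType) (F : filtration R) :
  noetherian R -> strongly_persistent F ->
  strongly_persistent (symbolic_filtration F).
Proof.
move=> noethR spF i; have Fi n := @filtration_ideal _ F n.
apply/seteqP; split=> [x xI|x xI y yI]; last first.
  (* This inclusion is multiplicativity of the symbolic filtration. *)
  rewrite -addn1; apply: (@symbolic_funM _ F i 1%N) => J [_]; apply.
  by exists x => //; exists y.
(* Index 0 is trivial, the target being [setT]. Otherwise [p] is also minimal over [F i.+2], where
   [x * a] is to be localized. *)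
case: i xI => [|i] xI //= p pmin; rewrite (filtration_Min _ _ i.+1) in pmin.
have [s F1s] := noethR _ (Fi 1%N).
have [a sa|u pu us] := @common_denominator _ p (F i.+2) s x (Fi _).
  apply/(contraction_extensionP _ _ (Fi _)).
  (* A generator [a] of [F 1] lies in its symbolic power, so the hypothesis on [x] applies to it. *)
  apply: (xI a) pmin; apply: sub_first_symbolic_power => //.
  by rewrite F1s => J [_]; apply.
apply/(contraction_extensionP _ _ (Fi _)); exists u => //.
rewrite -spF F1s; apply: ideal_gen_sub_colon => // a sa.
by rewrite -mulrA; exact: us.
Qed.
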